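(* Let $n\geq k$ be positive integers. There exist two orthogonal cyclic $k$-cycle decompositions of $K_{(2n+1)\times k}$ in each of the following cases: (1) $k\in\{3,7,9\}$ and $n\equiv 0,3\pmod 4$; (2) $k=5$ and $n\equiv 3\pmod 4$; (3) $k\in\{4,8\}$ and $n$ arbitrary; (4) $k=6$ and $n$ even.
   Context: $K_{q\times r}$ is the complete multipartite graph with $q$ parts, each of size $r$. A $k$-cycle decomposition of a graph $K$ is a set of subgraphs of $K$, each a cycle of length $k$, whose edge sets partition $E(K)$. It is cyclic if it admits a cyclic group of automorphisms (bijections of $V(K)$ leaving the decomposition invariant) acting sharply transitively on $V(K)$. Two cycle decompositions $\mathcal{D},\mathcal{D}'$ of the same simple graph are orthogonal if every $B\in\mathcal{D}$ and every $B'\in\mathcal{D}'$ have at most one edge in common. *)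

(* Defs.v *)
From mathcomp Require Import all_boot all_fingroup all_solvable.

Set Implicit Arguments.
Unset Strict Implicit.
Unset Printing Implicit Defensive.

(* A simple graph K with vertex set V(K) = V is given by its adjacency
   relation; its edges are the 2-subsets of V made of adjacent vertices. *)
Definition edges_of (V : finType) (adj : rel V) : {set {set V}} :=
  [set [set p.1; p.2] | p : V * V & adj p.1 p.2].

Definition complete_multipartite (q r : nat) : rel ('I_q * 'I_r) :=
  fun x y => x.1 != y.1.

(* A subgraph of a graph on V, as the pair (vertex set, edge set). *)
Definition subgraph (V : finType) : finType := ({set V} * {set {set V}})%type.

Definition sub_vertices (V : finType) (B : subgraph V) : {set V} := B.1.
Definition sub_edges (V : finType) (B : subgraph V) : {set {set V}} := B.2.

(* [next c x] is the cyclic successor of x in c. Lengths 1 and 2 are excluded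
   since they do not yield a cycle in a simple graph. *)
Definition is_cycle (V : finType) (k : nat) (B : subgraph V) : Prop :=
  2 < k /\
  exists c : seq V,
    [/\ size c = k, uniq c, sub_vertices B = [set x in c]
      & sub_edges B = [set [set x; next c x] | x in c]].

(* The injectivity clause makes the family of edge sets indexed by D, and not
   only its underlying set of edge sets, a partition. *)
Definition cycle_decomposition (V : finType) (adj : rel V) (k : nat)
    (D : {set subgraph V}) : Prop :=
  [/\ forall B, B \in D -> is_cycle k B,
      {in D &, injective (@sub_edges V)}
    & partition [set sub_edges B | B in D] (edges_of adj)].

Definition perm_subgraph (V : finType) (g : {perm V}) (B : subgraph V) :
    subgraph V :=
  (g @: sub_vertices B, [set g @: e | e : {set V} in sub_edges B]).

Definition sharply_transitive (V : finType) (G : {group {perm V}}) : Prop :=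
  forall x y : V, exists! g : {perm V}, g \in G /\ g x = y.

Definition cyclic_decomposition (V : finType) (D : {set subgraph V}) : Prop :=
  exists G : {group {perm V}},
    [/\ cyclic G, sharply_transitive G
      & forall g, g \in G -> [set perm_subgraph g B | B in D] = D].

Definition orthogonal_decompositions (V : finType)
    (D D' : {set subgraph V}) : Prop :=
  forall B B', B \in D -> B' \in D' ->
    #|sub_edges B :&: sub_edges B'| <= 1.

(* Main.v *)
(** Write v = k(2n+1) and identify the vertex set with Z_v, the parts being the
    cosets of the subgroup of order k. A cycle through the partial sums of a
    zero-sum sequence of k differences has v translates, so n such sequences
    using every +-difference outside the subgroup exactly once, each with pairwise
    distinct partial sums, develop into a cyclic k-cycle decomposition. Hence an
    n x n array with k filled cells in each row and column, whose entries cover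
    those differences once and whose rows and columns are such sequences, yields
    two decompositions, one from the rows and one from the columns; they are
    orthogonal because a row and a column share at most one cell.

    The array is cyclically diagonal. With M = 2n+1, a cell holds c + l M, where
    the class c is, up to sign, an element of a sequence x of period n with
    {|x_i|} = {1, ..., n}, or the main class -(x_i + x_{i+1}), resp. x_{i+2} - x_{i+1},
    at layer l = 0. The coefficients of x cancel formally in each row and column;
    what depends on n mod 4 is the existence of x for which the |x_i + x_{i+1}|,
    resp. the |x_{i+1} - x_i|, again run over {1, ..., n}. Such an x is a zigzag
    resembling a graceful labelling of the n-cycle. *)

Require Import Defs.
From mathcomp Require Import zify ring.
From mathcomp Require Import all_boot all_order all_fingroup all_solvable all_algebra.

Set Implicit Arguments.
Unset Strict Implicit.
Unset Printing Implicit Defensive.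

Import GRing.Theory.

(** * Partial sums and cycles given as sequences *)

Fixpoint psum (e : nat -> int) (t : nat) : int :=
  if t is t'.+1 then (psum e t' + e t')%R else 0%R.

Lemma dvdz_eq (d a b : int) : (d %| a)%Z -> b = a -> (d %| b)%Z.
Proof. by move=> da ->. Qed.

Lemma dvdz_eqN (d a b : int) : (d %| a)%Z -> b = (- a)%R -> (d %| b)%Z.
Proof. by move=> da ->; rewrite rpredN. Qed.

Definition subgraph_of_cycle (V : finType) (c : seq V) : subgraph V :=
  ([set x in c], [set [set x; next c x] | x in c]).

Lemma set2_inj (T : finType) (a b c d : T) :
  [set a; b] = [set c; d] -> (a = c /\ b = d) \/ (a = d /\ b = c).
Proof.
move=> E.
have A : a \in [set c; d] by rewrite -E set21.
have B : b \in [set c; d] by rewrite -E set22.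
have C : c \in [set a; b] by rewrite E set21.
have D : d \in [set a; b] by rewrite E set22.
move: A B C D; rewrite !in_set2.
by do 4![case/orP=> /eqP ?]; subst; auto.
Qed.

(** The assumption [f k = f 0] absorbs the wrap-around, so that every edge, the closing one
    included, joins [f t] to [f t.+1]. *)
Lemma next_mkseq (T : eqType) (f : nat -> T) k t :
  uniq (mkseq f k) -> t < k -> f k = f 0 -> next (mkseq f k) (f t) = f t.+1.
Proof.
case: k => [//|k] U ltk Ek; rewrite next_nth.
have Ei : index (f t) (mkseq f k.+1) = t.
  by rewrite -(nth_mkseq (f 0) f ltk) index_uniq ?size_mkseq.
have -> : f t \in mkseq f k.+1 by rewrite map_f // mem_iota.
rewrite Ei {Ei}.
rewrite -[LHS]/(nth (f 0) (mkseq f k.+1) t.+1).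
(* At the last index [nth] runs past the end and returns its default [f 0], the correct
   successor. *)
have [lt|ge] := ltnP t.+1 k.+1; first by rewrite nth_mkseq.
by rewrite nth_default ?size_mkseq // -Ek; congr f; lia.
Qed.

(** * Cyclic development of base cycles in a graph on the residues modulo v *)

Section CyclicDevelopment.

Variables (V : finType) (adj : rel V) (v : nat) (phi : int -> V).
Hypothesis v_gt0 : 0 < v.
Hypothesis phiE : forall a b, (phi a == phi b) = (v %| (a - b)%R)%Z.
Hypothesis phi_surj : forall x, exists a, phi a = x.
Hypothesis adj0 : forall a b, adj (phi a) (phi b) = adj (phi 0%R) (phi (b - a)%R).

Lemma phi_eq a b : (v %| (a - b)%R)%Z -> phi a = phi b.
Proof. by rewrite -phiE => /eqP. Qed.

Lemma phi_cong a b : phi a = phi b -> (v %| (a - b)%R)%Z.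
Proof. by rewrite -phiE => ->. Qed.

(** The last two fields make the 2nk residues of ±[e i t] distinct; equal indices in [base_asym]
    exclude differences of order at most 2. Both signs appear for [adj], which is not assumed
    symmetric. *)
Record base_cycles (n k : nat) (e : nat -> nat -> int) : Prop := BaseCycles {
  base_closed : forall i, i < n -> (v %| psum (e i) k)%Z;
  base_simple : forall i a b, i < n -> a < b -> b < k ->
    ~~ (v %| (psum (e i) b - psum (e i) a)%R)%Z;
  base_adj : forall i t, i < n -> t < k -> adj (phi 0%R) (phi (e i t));
  base_adjN : forall i t, i < n -> t < k -> adj (phi 0%R) (phi (- e i t)%R);
  base_inj : forall i t i' t', i < n -> t < k -> i' < n -> t' < k ->
    (v %| (e i t - e i' t')%R)%Z -> i = i' /\ t = t';
  base_asym : forall i t i' t', i < n -> t < k -> i' < n -> t' < k ->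
    ~~ (v %| (e i t + e i' t')%R)%Z }.

Definition translate (e : nat -> nat -> int) (k i : nat) (z : int) : subgraph V :=
  subgraph_of_cycle (mkseq (fun t => phi (z + psum (e i) t)%R) k).

Definition development (n k : nat) (e : nat -> nat -> int) : {set subgraph V} :=
  [set translate e k (val p.1) (val p.2)%:Z%R | p : 'I_n * 'I_v].

Lemma residue_ord z : exists m : 'I_v, (v %| (z - (m : nat)%:Z)%R)%Z.
Proof.
have z0 : (0 <= (z %% v)%Z)%R by apply: modz_ge0; lia.
have zv : `|(z %% v)%Z| < v by have := ltz_pmod z (d := v); lia.
by exists (Ordinal zv); rewrite /= gez0_abs // -eqz_mod_dvd modz_mod.
Qed.

Section OneFamily.

Variables (n k : nat) (e : nat -> nat -> int).
Hypothesis k_gt2 : 2 < k.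
Hypothesis He : base_cycles n k e.
Hypothesis degree : #|[set x | adj (phi 0%R) x]| = 2 * (n * k).

Let edge i (z : int) t : {set V} :=
  [set phi (z + psum (e i) t)%R; phi (z + psum (e i) t.+1)%R].

Lemma uniq_translate i z : i < n -> uniq (mkseq (fun t => phi (z + psum (e i) t)%R) k).
Proof.
move=> lti; apply/mkseq_uniqP => a b; rewrite !inE => lta ltb /phi_cong.
have -> : (z + psum (e i) a - (z + psum (e i) b) = psum (e i) a - psum (e i) b)%R by ring.
move=> D; case: (ltngtP a b) => // lt.
  by have /negP[] := base_simple He lti lt ltb; apply: dvdz_eqN D _; ring.
by have := base_simple He lti lt lta; rewrite D.
Qed.

Lemma mem_translate_edges i z E : i < n ->
  reflect (exists2 t, t < k & E = edge i z t) (E \in sub_edges (translate e k i z)).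
Proof.
move=> lti; have U := uniq_translate z lti.
set f := fun t => _ in U; have fk : f k = f 0.
  apply: phi_eq; rewrite /= addr0.
  have -> : (z + psum (e i) k - z = psum (e i) k)%R by ring.
  exact: base_closed He _ lti.
apply: (iffP imsetP) => [[x /mapP[t]]|[t ltk ->]].
  by rewrite mem_iota add0n => /= ltk -> ->; exists t; rewrite ?next_mkseq.
exists (f t); last by rewrite next_mkseq.
by apply: map_f; rewrite mem_iota.
Qed.

(** Subtracting endpoints leaves equal differences, settled by [base_inj], or, for a reversed match,
    opposite ones, excluded by [base_asym]. *)
Lemma edge_inj i z t i' z' t' : i < n -> t < k -> i' < n -> t' < k ->
  edge i z t = edge i' z' t' -> [/\ i = i', t = t' & (v %| (z - z')%R)%Z].
Proof.
move=> lti ltt lti' ltt' /set2_inj[] [/phi_cong D1 /phi_cong D2].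
  have [|? ?] := base_inj He lti ltt lti' ltt'.
    have -> : (e i t - e i' t' =
      (z + psum (e i) t.+1 - (z' + psum (e i') t'.+1))
      - (z + psum (e i) t - (z' + psum (e i') t')))%R by rewrite /=; ring.
    exact: rpredB.
  subst; split=> //.
  by apply: dvdz_eq D1 _; ring.
have /negP[] := base_asym He lti ltt lti' ltt'.
have -> : (e i t + e i' t' =
  (z + psum (e i) t.+1 - (z' + psum (e i') t'))
  - (z + psum (e i) t - (z' + psum (e i') t'.+1)))%R by rewrite /=; ring.
exact: rpredB.
Qed.

Lemma translate_mod i z z' : (v %| (z - z')%R)%Z -> translate e k i z = translate e k i z'.
Proof.
move=> D; congr subgraph_of_cycle; apply: eq_map => t; apply: phi_eq.
by apply: dvdz_eq D _; ring.
Qed.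

Lemma mem_development B :
  reflect (exists i z, i < n /\ B = translate e k i z) (B \in development n k e).
Proof.
apply: (iffP imsetP) => [[[i z] _ ->]|[i [z [lti ->]]]].
  by exists i, (z : nat)%:Z%R; split.
have [m D] := residue_ord z.
by exists (Ordinal lti, m) => //=; apply: translate_mod.
Qed.

(** By counting: the ±[e i t] give 2nk distinct neighbours of 0, and [degree] says that there are no
    others. *)
Lemma base_cover z : adj (phi 0%R) (phi z) ->
  exists i t, [/\ i < n, t < k & (v %| (z - e i t)%R)%Z || (v %| (z + e i t)%R)%Z].
Proof.
pose F (p : 'I_n * 'I_k * bool) :=
  phi (if p.2 then e p.1.1 p.1.2 else - e p.1.1 p.1.2)%R.
have Finj : injective F.
  move=> [[i t] b] [[i' t'] b']; rewrite /F /= => /phi_cong D.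
  have [Eb|nb] := eqVneq b b'.
    have [|/val_inj-> /val_inj->] := base_inj He (ltn_ord i) (ltn_ord t)
      (ltn_ord i') (ltn_ord t'); last by rewrite Eb.
    by move: D; rewrite -Eb; case: b {Eb} => //= D; apply: dvdz_eqN D _; ring.
  have /negP A := base_asym He (ltn_ord i) (ltn_ord t) (ltn_ord i') (ltn_ord t').
  case: b nb D => nb D; case: b' nb D => //= _ D; case: A.
    by apply: dvdz_eq D _; ring.
  by apply: dvdz_eqN D _; ring.
have sub : F @: setT \subset [set x | adj (phi 0%R) x].
  apply/subsetP => _ /imsetP[[[i t] b] _ ->]; rewrite inE /F /=.
  by case: b; [apply: (base_adj He)|apply: (base_adjN He)]; rewrite ltn_ord.
have /eqP FT : F @: setT == [set x | adj (phi 0%R) x].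
  rewrite eqEcard sub degree card_imset // cardsT !card_prod !card_ord card_bool.
  by rewrite [X in _ <= X]mulnC leqnn.
move=> az; have : phi z \in F @: setT by rewrite FT inE.
case/imsetP=> [[[i t] b] _] /phi_cong /= D; exists i, t; split=> //.
case: b D => D; first by rewrite D.
by rewrite opprK in D; rewrite D orbT.
Qed.

(** Uniqueness rests on [edges_eq]: translates with a common edge coincide. For covering,
    [base_cover] finds a base cycle with the right difference, which is then shifted onto the
    edge. *)
Lemma development_decomposition : cycle_decomposition adj k (development n k e).
Proof.
have edges_eq i z i' z' E : i < n -> i' < n ->
    E \in sub_edges (translate e k i z) -> E \in sub_edges (translate e k i' z') ->
    translate e k i z = translate e k i' z'.
  move=> lti lti' /mem_translate_edges[//|t ltt ->] /mem_translate_edges[//|t' ltt'].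
  by case/edge_inj=> // <- _ /translate_mod.
have edge0 i z : i < n -> edge i z 0 \in sub_edges (translate e k i z).
  by move=> lti; apply/mem_translate_edges => //; exists 0 => //; lia.
split=> [B /mem_development[i [z [lti ->]]]|B B'|].
- split=> //; exists (mkseq (fun t => phi (z + psum (e i) t)%R) k).
  by rewrite size_mkseq uniq_translate.
- move=> /mem_development[i [z [lti ->]]] /mem_development[i' [z' [lti' ->]]] E.
  by apply: (edges_eq _ _ _ _ (edge i z 0)) => //; rewrite -?E edge0.
apply/and3P; split.
- apply/eqP/setP => E; apply/bigcupP/imsetP => [[A /imsetP[B]]|[[x y] /=]].
    case/mem_development=> i [z [lti ->]] -> /(mem_translate_edges _ _ lti)[t ltt ->].
    exists (phi (z + psum (e i) t)%R, phi (z + psum (e i) t.+1)%R) => //.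
    rewrite inE /= adj0 /=.
    have -> : (z + (psum (e i) t + e i t) - (z + psum (e i) t) = e i t)%R by ring.
    exact: (base_adj He).
  case: (phi_surj x) => a <-; case: (phi_surj y) => b <- A ->.
  rewrite inE /= adj0 in A; have [i [t [lti ltt]]] := base_cover A.
  case/orP=> D.
    exists (sub_edges (translate e k i (a - psum (e i) t)%R)).
      by apply: imset_f; apply/mem_development; exists i, (a - psum (e i) t)%R.
    apply/mem_translate_edges => //; exists t => //; rewrite /edge.
    by congr [set _; _]; apply: phi_eq; [rewrite subrK subrr | apply: dvdz_eq D _ => /=; ring].
  (* Here [b - a] is the negative of [e i t], so the cycle runs through the edge from [b] to [a]. *)
  exists (sub_edges (translate e k i (b - psum (e i) t)%R)).
    by apply: imset_f; apply/mem_development; exists i, (b - psum (e i) t)%R.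
  apply/mem_translate_edges => //; exists t => //; rewrite /edge setUC.
  congr [set _; _]; apply: phi_eq; first by rewrite subrK subrr.
  by apply: dvdz_eqN D _ => /=; ring.
- apply/trivIsetP => X Y /imsetP[B /mem_development[i [z [lti ->]]] ->].
  move=> /imsetP[B' /mem_development[i' [z' [lti' ->]]] ->] neq.
  apply/pred0P => E /=; apply/negP => /andP[E1 E2].
  by move: neq; rewrite (edges_eq _ _ _ _ _ lti lti' E1 E2) eqxx.
apply/imsetP => -[B /mem_development[i [z [lti ->]]]] E.
by have := edge0 i z lti; rewrite -E inE.
Qed.

Lemma perm_translate (g : {perm V}) i z a : i < n -> (forall w, g (phi w) = phi (w + a)%R) ->
  perm_subgraph g (translate e k i z) = translate e k i (z + a)%R.
Proof.
move=> lti gE; rewrite /translate; have Uc := uniq_translate z lti.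
set c := mkseq _ k in Uc *.
have -> : mkseq (fun t => phi (z + a + psum (e i) t)%R) k = map g c.
  by rewrite -map_comp; apply: eq_map => t /=; rewrite gE addrAC.
congr pair; apply/setP => x.
  rewrite inE; apply/imsetP/mapP => [[y yc ->]|[y yc ->]]; exists y => //.
    by rewrite inE in yc.
  by rewrite inE.
apply/imsetP/imsetP => [[_ /imsetP[y yc ->] ->]|[_ /mapP[y yc ->] ->]].
  exists (g y); first exact: map_f.
  by rewrite imsetU1 imset_set1 (next_map perm_inj).
exists [set y; next c y]; first exact: imset_f.
by rewrite imsetU1 imset_set1 (next_map perm_inj).
Qed.

End OneFamily.

(** The group is generated by the translation by 1, transported along [phi] as [s]. *)
Lemma development_cyclic n k e : base_cycles n k e ->
  cyclic_decomposition (development n k e).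
Proof.
move=> He; have surj x : exists a, phi a == x.
  by have [a <-] := phi_surj x; exists a.
pose s x := phi (xchoose (surj x) + 1)%R.
have sE a : s (phi a) = phi (a + 1)%R.
  rewrite /s; set h := (X in xchoose X); have /eqP/phi_cong D := xchooseP h.
  by apply: phi_eq; apply: dvdz_eq D _; ring.
have s_inj : injective s.
  move=> x y; case: (phi_surj x) => a <-; case: (phi_surj y) => b <-.
  rewrite !sE => /phi_cong D; by apply: phi_eq; apply: dvdz_eq D _; ring.
pose g := perm s_inj.
have gX m a : (g ^+ m)%g (phi a) = phi (a + m%:Z)%R.
  elim: m => [|m IH]; first by rewrite expg0 perm1 addr0.
  rewrite expgSr permM IH permE sE; congr phi; lia.
have Dsub h : h \in <[g]>%g ->
    [set perm_subgraph h B | B in development n k e] \subset development n k e.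
  case/cycleP=> m ->; apply/subsetP => X /imsetP[B /mem_development[i [z [lti ->]]] ->].
  apply/mem_development; exists i, (z + m%:Z)%R; split=> //.
  by apply: (perm_translate He) => // w; apply: gX.
exists <[g]>%G; split; first exact: cycle_cyclic.
  move=> x y; case: (phi_surj x) => a <-; case: (phi_surj y) => b <-.
  have [m D] := residue_ord (b - a)%R.
  exists (g ^+ m)%g; split=> [|h [/cycleP[m' ->]]].
    by rewrite mem_cycle gX; split=> //; apply: phi_eq; apply: dvdz_eqN D _; ring.
  rewrite gX => /phi_cong D'; apply/permP => w; case: (phi_surj w) => c <-.
  by rewrite !gX; apply: phi_eq; apply: dvdz_eqN (rpredD D D') _; ring.
(* The reverse inclusion is [Dsub] applied to the inverse of [h]. *)
move=> h hG; apply/eqP; rewrite eqEsubset Dsub //.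
have hV : (h^-1)%g \in <[g]>%g by rewrite groupV.
apply/subsetP => B BD.
have BD' : perm_subgraph h^-1%g B \in development n k e.
  by apply: (subsetP (Dsub _ hV)); apply: imset_f.
apply/imsetP; exists (perm_subgraph h^-1%g B) => //.
have hK (A : {set V}) : h @: (h^-1%g @: A) = A.
  by rewrite -imset_comp -[RHS]imset_id; apply: eq_imset => x /=; rewrite permKV.
case: B {BD BD'} => B1 B2; rewrite /perm_subgraph /sub_vertices /sub_edges /= hK; congr pair.
by rewrite -imset_comp -[LHS]imset_id; apply: eq_imset => A /=; rewrite hK.
Qed.

(** A common edge forces [e i t] = ±[e' j u]; the last hypothesis allows this for only one [t] when
    [i] and [j] are fixed, and [t] determines the edge of the translate. *)
Lemma development_orthogonal n k e e' :
  base_cycles n k e -> base_cycles n k e' ->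
  (forall i j t u t' u', i < n -> j < n -> t < k -> u < k -> t' < k -> u' < k ->
    (v %| (e i t - e' j u)%R)%Z || (v %| (e i t + e' j u)%R)%Z ->
    (v %| (e i t' - e' j u')%R)%Z || (v %| (e i t' + e' j u')%R)%Z -> t = t') ->
  orthogonal_decompositions (development n k e) (development n k e').
Proof.
move=> He He' O B B' /mem_development[i [z [lti ->]]] /mem_development[j [w [ltj ->]]].
have cmp t u : [set phi (z + psum (e i) t)%R; phi (z + psum (e i) t.+1)%R]
    = [set phi (w + psum (e' j) u)%R; phi (w + psum (e' j) u.+1)%R] ->
    (v %| (e i t - e' j u)%R)%Z || (v %| (e i t + e' j u)%R)%Z.
  move=> /set2_inj[] [/phi_cong D1 /phi_cong D2]; apply/orP; [left|right];
    by apply: dvdz_eq (rpredB D2 D1) _ => /=; ring.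
apply/card_le1_eqP => E1 E2; rewrite !inE => /andP[].
case/(mem_translate_edges He _ _ lti)=> t ltt ->.
case/(mem_translate_edges He' _ _ ltj)=> u ltu /cmp Ct /andP[].
case/(mem_translate_edges He _ _ lti)=> t' ltt' ->.
case/(mem_translate_edges He' _ _ ltj)=> u' ltu' /cmp Ct'.
by rewrite (O i j t u t' u').
Qed.


End CyclicDevelopment.

(** * The vertex set as the residues modulo kM *)

Section Vertices.

Variables (M k : nat).
Hypotheses (M_gt0 : 0 < M) (k_gt0 : 0 < k).

Let residue (z : int) : nat := `|(z %% (k * M)%N)%Z|.

Definition vertex (z : int) : 'I_M * 'I_k :=
  (Ordinal (ltn_pmod (residue z) M_gt0), Ordinal (ltn_pmod (residue z %/ M) k_gt0)).

Let residueE z : (residue z)%:Z%R = (z %% (k * M)%N)%Z.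
Proof. by rewrite gez0_abs // modz_ge0 // eqz_nat -lt0n muln_gt0 k_gt0. Qed.

Let residue_lt z : residue z < k * M.
Proof.
rewrite -ltz_nat residueE ltz_pmod //.
by rewrite ltz_nat muln_gt0 k_gt0.
Qed.

Lemma vertexE a b : (vertex a == vertex b) = ((k * M)%N %| (a - b)%R)%Z.
Proof.
rewrite -eqz_mod_dvd -!residueE eqz_nat.
apply/eqP/eqP => [[E1 E2]|E]; last by congr pair; apply: val_inj; rewrite /= E.
have lt c : residue c %/ M < k by rewrite ltn_divLR // residue_lt.
rewrite !modn_small // in E2.
by rewrite (divn_eq (residue a) M) (divn_eq (residue b) M) E1 E2.
Qed.

Lemma vertex_surj x : exists a, vertex a = x.
Proof.
case: x => x y; exists (y * M + x)%N%:Z%R.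
have lt : y * M + x < k * M.
  apply: (@leq_trans (y.+1 * M)); last by rewrite leq_mul2r ltn_ord orbT.
  by rewrite mulSn addnC ltn_add2r.
have E : residue (y * M + x)%N%:Z%R = y * M + x.
  by rewrite /residue modz_nat modn_small.
congr pair; apply: val_inj; rewrite /= E.
  by rewrite modnMDl modn_small.
by rewrite divnMDl // divn_small // addn0 modn_small.
Qed.

Lemma multipartite_vertex a b :
  complete_multipartite (vertex a) (vertex b) = ~~ (M %| (a - b)%R)%Z.
Proof.
rewrite /complete_multipartite -eqz_mod_dvd -val_eqE /=; congr (~~ _).
have E c : ((residue c %% M)%N%:Z)%R = (c %% M)%Z.
  rewrite -modz_nat residueE; apply/eqP; rewrite eqz_mod_dvd.
  apply: (@dvdz_trans (k * M)%N); first by rewrite PoszM dvdz_mull.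
  by rewrite -eqz_mod_dvd modz_mod.
by rewrite -!E eqz_nat.
Qed.

Lemma multipartite_vertex0 a b :
  complete_multipartite (vertex a) (vertex b)
  = complete_multipartite (vertex 0%R) (vertex (b - a)%R).
Proof. by rewrite !multipartite_vertex sub0r opprB. Qed.

Lemma multipartite_degree :
  #|[set x | complete_multipartite (vertex 0%R) x]| = M.-1 * k.
Proof.
have -> : [set x | complete_multipartite (vertex 0%R) x]
    = setX [set~ (vertex 0%R).1] [set: 'I_k].
  by apply/setP => x; rewrite !inE /complete_multipartite andbT eq_sym.
by rewrite cardsX cardsT cardsC1 !card_ord.
Qed.

End Vertices.

(** * From layered arrays to orthogonal decompositions *)

Definition closed_simple (v k : nat) (e : nat -> int) : Prop :=
  (v %| psum e k)%Z /\
  forall a b, a < b -> b < k -> ~~ (v %| (psum e b - psum e a)%R)%Z.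

(** Divisibility by kM makes [a] a multiple of M, and the bound leaves only 0, M and -M; [s] is the
    carry into the layer. *)
Lemma dvdz_layer (k M : nat) (a b : int) : `|a| < 2 * M ->
  ((k * M)%N %| (a + b * M%:Z)%R)%Z ->
  exists2 s : int, a = (s * M%:Z)%R & (k %| (b + s)%R)%Z /\ (-1 <= s <= 1)%R.
Proof.
move=> lt /dvdzP[q E]; exists (q * k%:Z - b)%R; first by move: E; rewrite PoszM; lia.
split; first by apply/dvdzP; exists q; lia.
have E' : (a = (q * k%:Z - b) * M%:Z)%R by move: E; rewrite PoszM; lia.
by move: (q * k%:Z - b)%R E' => s E'; nia.
Qed.

Lemma dvdz_layer0 (k M : nat) (a b : int) : `|a| < M ->
  ((k * M)%N %| (a + b * M%:Z)%R)%Z -> a = 0%R /\ (k %| b)%Z.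
Proof.
move=> lt /dvdz_layer[|s E [D _]]; first by lia.
have s0 : s = 0%R by nia.
by move: D; rewrite E s0 mul0r addr0.
Qed.

Section LayeredArray.

Variables (n k : nat).
Let M := 2 * n + 1.

(* Cell t of row i lies in column i + d t modulo n and holds c i t + j i t * M.
   The last field concerns column i + K; listing its cell t in row i + (K - d t)
   avoids subtractions modulo n. *)
Record layered_array (d : nat -> nat) (K : nat) (c j : nat -> nat -> int) : Prop :=
  LayeredArray {
  offset_le : forall t, t < k -> d t <= K;
  offset_inj : forall t u, t < k -> u < k -> d t = d u %[mod n] -> t = u;
  class_periodic : forall i i' t, t < k -> i = i' %[mod n] -> c i t = c i' t;
  class_range : forall i t, t < k -> 0 < `|c i t| <= n;
  cell_inj : forall i i' t u, t < k -> u < k ->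
    c i t = c i' u /\ (k %| (j i t - j i' u)%R)%Z \/
    c i t = (- c i' u)%R /\ (k %| (j i t + j i' u)%R)%Z ->
    t = u /\ i = i' %[mod n];
  row_closed_simple : forall i,
    closed_simple (k * M) k (fun t => (c i t + j i t * M%:Z)%R);
  column_closed_simple : forall i,
    closed_simple (k * M) k
      (fun t => (c (i + (K - d t))%N t + j (i + (K - d t))%N t * M%:Z)%R) }.

Variables (d : nat -> nat) (K : nat) (c j : nat -> nat -> int).
Hypothesis A : layered_array d K c j.
Hypothesis k_gt2 : 2 < k.

Let entry i t : int := (c i t + j i t * M%:Z)%R.

Let k_gt0 : 0 < k. Proof. by apply: ltn_trans k_gt2. Qed.
Let M_gt0 : 0 < M. Proof. by rewrite /M addn1. Qed.
Let phi := vertex M_gt0 k_gt0.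

(** Classes are at most n in absolute value, so that their differences stay below M = 2n+1 and
    classes and layers can be compared separately. *)
Lemma entry_eq i i' t u : t < k -> u < k ->
  ((k * M)%N %| (entry i t - entry i' u)%R)%Z -> t = u /\ i = i' %[mod n].
Proof.
move=> ltt ltu D; apply: (cell_inj A) => //; left.
have [||E D'] := @dvdz_layer0 k M (c i t - c i' u)%R (j i t - j i' u)%R.
- by have := class_range A i ltt; have := class_range A i' ltu; rewrite /M; lia.
- by apply: dvdz_eq D _; rewrite /entry; ring.
by split=> //; lia.
Qed.

(** Opposite entries would lie in the same cell by [cell_inj], and its class would be its own
    negative, hence zero. *)
Lemma entry_opp i i' t u : t < k -> u < k ->
  ~~ ((k * M)%N %| (entry i t + entry i' u)%R)%Z.
Proof.
move=> ltt ltu; apply/negP => D.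
have [||E D'] := @dvdz_layer0 k M (c i t + c i' u)%R (j i t + j i' u)%R.
- by have := class_range A i ltt; have := class_range A i' ltu; rewrite /M; lia.
- by apply: dvdz_eq D _; rewrite /entry; ring.
have [|tu ii'] := cell_inj A (i := i) (i' := i') ltt ltu.
  by right; split=> //; lia.
have := class_range A i ltt; have := class_periodic A ltt ii'.
by move: E; rewrite -tu; lia.
Qed.

Lemma shifted_base_cycles (s : nat -> nat) :
  (forall i, closed_simple (k * M) k (fun t => entry (i + s t) t)) ->
  base_cycles (@complete_multipartite M k) (k * M) phi n k
    (fun i t => entry (i + s t) t).
Proof.
have adj i t (b : bool) : t < k ->
    complete_multipartite (phi 0%R) (phi (if b then entry i t else - entry i t)%R).
  move=> ltt; rewrite multipartite_vertex sub0r rpredN; apply/negP => D.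
  (* With 1 in place of [k], [dvdz_layer0] turns divisibility by M into a vanishing class. *)
  have D' : ((1 * M)%N %| (c i t + j i t * M%:Z)%R)%Z.
    by rewrite mul1n; case: b D => //; rewrite rpredN.
  have lt := class_range A i ltt.
  have [|E _] := dvdz_layer0 _ D'; first by rewrite /M; lia.
  by lia.
move=> cs; split.
- by move=> i _; case: (cs i).
- by move=> i a b _; case: (cs i) => _; apply.
- by move=> i t _ /(adj (i + s t) t true).
- by move=> i t _ /(adj (i + s t) t false).
- move=> i t i' u lti ltt lti' ltu /entry_eq[] // -> /eqP.
  by rewrite eqn_modDr !modn_small // => /eqP.
- by move=> i t i' u _ ltt _ ltu; apply: entry_opp.
Qed.

Theorem layered_array_decompositions :
  exists D D' : {set subgraph ('I_M * 'I_k)%type},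
    [/\ cycle_decomposition (@complete_multipartite M k) k D,
        cycle_decomposition (@complete_multipartite M k) k D',
        cyclic_decomposition D,
        cyclic_decomposition D'
      & orthogonal_decompositions D D'].
Proof.
pose row i t := entry (i + 0) t; pose col i t := entry (i + (K - d t)) t.
have Hrow : base_cycles (@complete_multipartite M k) (k * M) phi n k row.
  apply: (@shifted_base_cycles (fun=> 0)) => i; rewrite addn0.
  exact: row_closed_simple A i.
have Hcol : base_cycles (@complete_multipartite M k) (k * M) phi n k col.
  exact: (@shifted_base_cycles (fun t => K - d t)) (column_closed_simple A).
have v_gt0 : 0 < k * M by rewrite muln_gt0 k_gt0 M_gt0.
have phiE := vertexE M_gt0 k_gt0.
have phi_surj := vertex_surj M_gt0 k_gt0.
have adj0 := multipartite_vertex0 M_gt0 k_gt0.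
have degree : #|[set x | complete_multipartite (phi 0%R) x]| = 2 * (n * k).
  by rewrite multipartite_degree /M addn1 /= mulnA.
exists (development (k * M) phi n k row), (development (k * M) phi n k col).
split.
- exact: (development_decomposition v_gt0 phiE phi_surj adj0 k_gt2 Hrow degree).
- exact: (development_decomposition v_gt0 phiE phi_surj adj0 k_gt2 Hcol degree).
- exact: (development_cyclic v_gt0 phiE phi_surj Hrow).
- exact: (development_cyclic v_gt0 phiE phi_surj Hcol).
apply: (development_orthogonal v_gt0 phiE Hrow Hcol).
(* A common difference at position [t] means i + d t = l + K modulo n; this fixes [d t] and, by
   [offset_inj], [t]. *)
have meet i l t u : t < k -> u < k ->
    ((k * M)%N %| (row i t - col l u)%R)%Z || ((k * M)%N %| (row i t + col l u)%R)%Z ->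
    i = l + (K - d t) %[mod n].
  move=> ltt ltu; rewrite (negPf (entry_opp _ _ ltt ltu)) orbF.
  by case/entry_eq=> // ->; rewrite addn0.
move=> i l t u t' u' lti ltl ltt ltu ltt' ltu' /meet E1 /meet E2.
apply: (offset_inj A) => //; apply/eqP.
have lt := offset_le A ltt; have lt' := offset_le A ltt'.
have /eqP := E1 ltt ltu; rewrite (E2 ltt' ltu') eqn_modDl.
rewrite -(eqn_modDr (d t)) subnK // -(eqn_modDr (d t')) -addnA [d t + _]addnC addnA subnK //.
by rewrite eqn_modDl eq_sym.
Qed.

End LayeredArray.

(** * Zigzag sequences with prescribed neighbour differences or sums *)

(* The absolute values over one period form a permutation of 1, ..., n. *)
Definition spread (n : nat) (x : nat -> int) : Prop :=
  [/\ forall i i', i = i' %[mod n] -> x i = x i',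
      forall i, 0 < `|x i| <= n
    & forall i i', `|x i| = `|x i'| -> i = i' %[mod n]].

Lemma succ_mod n i : 0 < n ->
  i.+1 %% n = if (i %% n).+1 == n then 0 else (i %% n).+1.
Proof.
move=> n0; have lt := ltn_pmod i n0; rewrite -addn1 -modnDml addn1.
by case: eqP => [->|neq]; rewrite ?modnn // modn_small //; lia.
Qed.

Lemma spread_cyclic_pairs n (f : int -> int -> int) (y : nat -> int) : 0 < n ->
  let z i := f (y i) (y (if i.+1 == n then 0 else i.+1)) in
  (forall i, i < n -> 0 < `|z i| <= n) ->
  (forall i i', i < n -> i' < n -> `|z i| = `|z i'| -> i = i') ->
  spread n (fun i => f (y (i %% n)) (y (i.+1 %% n))).
Proof.
move=> n0 z R I.
have E i : f (y (i %% n)) (y (i.+1 %% n)) = z (i %% n) by rewrite succ_mod.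
split=> [i i' ii'|i|i i'].
- by rewrite !E ii'.
- by rewrite E R ?ltn_pmod.
- by rewrite !E; apply: I; rewrite ltn_pmod.
Qed.

Lemma spread_cyclic n (y : nat -> int) : 0 < n ->
  (forall i, i < n -> 0 < `|y i| <= n) ->
  (forall i i', i < n -> i' < n -> `|y i| = `|y i'| -> i = i') ->
  spread n (fun i => y (i %% n)).
Proof. by move=> n0; apply: (spread_cyclic_pairs (f := fun a _ => a)). Qed.

(** Negating the odd positions turns differences into sums up to sign; for even n the sign pattern
    has period n. *)
Lemma spread_alternate n (x : nat -> int) : ~~ odd n ->
  spread n x -> spread n (fun i => x i.+1 - x i)%R ->
  let x' i := if odd i then (- x i)%R else x i in
  spread n x' /\ spread n (fun i => x' i + x' i.+1)%R.
Proof.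
move=> en [P R I] [P' R' I'] x'.
have par i i' : i = i' %[mod n] -> odd i = odd i'.
  move=> E; rewrite (divn_eq i n) (divn_eq i' n) E !oddD !oddM.
  by rewrite (negPf en) !andbF.
have A i : `|x' i| = `|x i| by rewrite /x'; case: odd; rewrite ?abszN.
have A' i : `|(x' i + x' i.+1)%R| = `|(x i.+1 - x i)%R|.
  by rewrite /x' /=; case: odd => /=; lia.
split; split.
- by move=> i i' E; rewrite /x' (par _ _ E) (P _ _ E).
- by move=> i; rewrite A.
- by move=> i i'; rewrite !A; apply: I.
- move=> i i' E; have E1 : i.+1 = i'.+1 %[mod n].
    by rewrite -(addn1 i) -(addn1 i') -modnDml E modnDml.
  by rewrite /x' (par _ _ E) (P _ _ E) (par _ _ E1) (P _ _ E1).
- by move=> i; rewrite A'.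
- by move=> i i'; rewrite !A'; apply: I'.
Qed.

(* For n = 4m: the two interleaved monotone runs take the differences
   2m-2, ..., 1 and 4m-1, ..., 2m+2; the two last values supply the others. *)
Definition zigzag0 (m i : nat) : int :=
  if i < 2 * m - 1 then (if odd i then m + 2 + i./2 else 3 * m - i./2)%N%:Z%R
  else if i < 4 * m - 2 then (if odd i then 5 * m - i./2.+1 else i./2 + 1 - m)%N%:Z%R
  else if i == 4 * m - 2 then (m + 1)%N%:Z%R else (- m%:Z)%R.

(** For n = 4m+3: the runs on positions 1, ..., 2m and 2m+1, ..., 4m+2 take the differences 4m+2,
    ..., 2m+4 and 2m+2, ..., 2, and their junction takes 1. Position 0 holds the absolute value 2m+2
    missing from the runs and supplies 2m+3 and 4m+3. *)
Definition zigzag3 (m i : nat) : int :=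
  if i == 0 then (- (2 * m + 2)%N%:Z)%R
  else if i <= 2 * m then (if odd i then i./2.+1 else 4 * m + 4 - i./2)%N%:Z%R
  else (if odd i then 4 * m + 3 - i./2 else i./2)%N%:Z%R.

(** For odd n the sign alternation breaks at the wrap-around, where two positive entries add up to
    4m+3. *)
Definition zigzag_sum3 (m i : nat) : int :=
  if odd i then (- (if i <= 2 * m then m + 2 + i./2 else 5 * m + 3 - i./2)%N%:Z)%R
  else (if i <= 2 * m then 3 * m + 2 - i./2 else i./2 - m)%N%:Z%R.

Ltac split_ifs :=
  repeat match goal with |- context [if ?b then _ else _] =>
    lazymatch b with
    | context [if _ then _ else _] => fail
    | _ => case: (boolP b) => ?; try (exfalso; lia)
    end end.

Lemma zigzag0_spread m : 0 < m ->
  spread (4 * m) (fun i => zigzag0 m (i %% (4 * m))) /\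
  spread (4 * m) (fun i => zigzag0 m (i.+1 %% (4 * m)) - zigzag0 m (i %% (4 * m)))%R.
Proof.
move=> m0; have n0 : 0 < 4 * m by lia.
have R i : i < 4 * m -> 0 < `|zigzag0 m i| <= 4 * m.
  by rewrite /zigzag0 => lti; split_ifs; lia.
split.
  apply: spread_cyclic => // i i' lti lti'; rewrite /zigzag0.
  by split_ifs; lia.
(* [D] is a closed form of the cyclic absolute differences; with it, comparing two indices involves
   only linear pieces. *)
pose D i := if i < 2 * m - 2 then 2 * m - 2 - i else if i == 2 * m - 2 then 2 * m - 1
  else if i < 4 * m - 3 then 6 * m - 2 - i else if i == 4 * m - 3 then 2 * m
  else if i == 4 * m - 2 then 2 * m + 1 else 4 * m.
have DE i : i < 4 * m ->
    `|(zigzag0 m (if i.+1 == 4 * m then 0 else i.+1) - zigzag0 m i)%R| = D i.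
  move=> lti; case: ifP => E; rewrite /zigzag0 /D; split_ifs; lia.
apply: (spread_cyclic_pairs (f := fun a b => (b - a)%R)) => // [i lti|i i' lti lti'].
  by rewrite DE // /D; split_ifs; lia.
by rewrite !DE // /D; split_ifs; lia.
Qed.

Lemma zigzag3_spread m : 0 < m ->
  spread (4 * m + 3) (fun i => zigzag3 m (i %% (4 * m + 3))) /\
  spread (4 * m + 3)
    (fun i => zigzag3 m (i.+1 %% (4 * m + 3)) - zigzag3 m (i %% (4 * m + 3)))%R.
Proof.
move=> m0; have n0 : 0 < 4 * m + 3 by lia.
split.
  apply: spread_cyclic => // [i lti|i i' lti lti']; rewrite /zigzag3.
    by split_ifs; lia.
  by split_ifs; lia.
pose D i := if i == 0 then 2 * m + 3 else if i < 2 * m then 4 * m + 3 - i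
  else if i == 2 * m then 1 else if i < 4 * m + 2 then 4 * m + 3 - i else 4 * m + 3.
have DE i : i < 4 * m + 3 ->
    `|(zigzag3 m (if i.+1 == 4 * m + 3 then 0 else i.+1) - zigzag3 m i)%R| = D i.
  by move=> lti; case: ifP => E; rewrite /D /zigzag3; split_ifs; lia.
apply: (spread_cyclic_pairs (f := fun a b => (b - a)%R)) => // [i lti|i i' lti lti'].
  by rewrite DE // /D; split_ifs; lia.
by rewrite !DE // /D; split_ifs; lia.
Qed.

Lemma zigzag_sum3_spread m :
  spread (4 * m + 3) (fun i => zigzag_sum3 m (i %% (4 * m + 3))) /\
  spread (4 * m + 3)
    (fun i => zigzag_sum3 m (i %% (4 * m + 3)) + zigzag_sum3 m (i.+1 %% (4 * m + 3)))%R.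
Proof.
have n0 : 0 < 4 * m + 3 by lia.
split.
  apply: spread_cyclic => // [i lti|i i' lti lti']; rewrite /zigzag_sum3.
    by split_ifs; lia.
  by split_ifs; lia.
pose D i := if i < 2 * m then 2 * m - i else if i == 2 * m then 2 * m + 1
  else if i < 4 * m + 2 then 6 * m + 3 - i else 4 * m + 3.
have DE i : i < 4 * m + 3 ->
    `|(zigzag_sum3 m i + zigzag_sum3 m (if i.+1 == 4 * m + 3 then 0 else i.+1))%R| = D i.
  by move=> lti; case: ifP => E; rewrite /D /zigzag_sum3; split_ifs; lia.
apply: (spread_cyclic_pairs (f := fun a b => (a + b)%R)) => // [i lti|i i' lti lti'].
  by rewrite DE // /D; split_ifs; lia.
by rewrite !DE // /D; split_ifs; lia.
Qed.

Lemma difference_sequence n : 4 <= n -> n = 0 %[mod 4] \/ n = 3 %[mod 4] ->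
  exists x, spread n x /\ spread n (fun i => x i.+1 - x i)%R.
Proof.
move=> n4 [] E.
  have -> : n = 4 * (n %/ 4) by rewrite {1}(divn_eq n 4); lia.
  by eexists; apply: (@zigzag0_spread (n %/ 4)); lia.
have -> : n = 4 * (n %/ 4) + 3 by rewrite {1}(divn_eq n 4); lia.
by eexists; apply: (@zigzag3_spread (n %/ 4)); lia.
Qed.

(** Multiples of 4 come from a difference sequence by alternating signs. The other residue has its
    own sequence, which includes n = 3, as k = 3 requires. *)
Lemma sum_sequence n : 0 < n -> n = 0 %[mod 4] \/ n = 3 %[mod 4] ->
  exists x, spread n x /\ spread n (fun i => x i + x i.+1)%R.
Proof.
move=> n0 [] E; last first.
  have -> : n = 4 * (n %/ 4) + 3 by rewrite {1}(divn_eq n 4); lia.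
  by eexists; apply: zigzag_sum3_spread.
have [||x [X D]] := @difference_sequence n; [by lia | by left |].
by eexists; apply: spread_alternate X D; lia.
Qed.

(** * Arrays described by finite tables *)

(* [Some (neg, s)] stands for the class x_{i+s}, negated when [neg] holds; [None]
   marks the single main diagonal. *)
Definition cell_class (main : (nat -> int) -> nat -> int) (x : nat -> int)
    (cell : option (bool * nat)) (i : nat) : int :=
  if cell is Some (neg, s) then if neg then (- x (i + s)%N)%R else x (i + s)%N
  else main x i.

(* A difference is determined up to sign by |c| and by the layer taken with the
   sign of its cell, modulo k. *)
Definition signed_layer (cell : option (bool * nat)) (l : int) : int :=
  if cell is Some (neg, _) then if neg then (- l)%R else l else 0%R.

Lemma psum_layers (M : nat) (c j : nat -> int) t :
  psum (fun u => (c u + j u * M%:Z)%R) t = (psum c t + psum j t * M%:Z)%R.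
Proof. by elim: t => [|t IH] /=; rewrite ?IH; ring. Qed.

(** A recursive form, which unfolds into a finite conjunction for a concrete bound. *)
Fixpoint forall_lt (k : nat) (P : nat -> Prop) : Prop :=
  if k is k'.+1 then forall_lt k' P /\ P k' else True.

Lemma forall_ltP k P : forall_lt k P -> forall a, a < k -> P a.
Proof.
elim: k => //= k IH [/IH H Pk] a; rewrite ltnS leq_eqVlt.
by case/orP=> [/eqP-> //|/H].
Qed.

(* Two partial sums whose classes differ by less than 2M can only be congruent
   modulo kM when their classes differ by 0, M or -M. *)
Lemma closed_simple_layers (M k : nat) (c j : nat -> int) :
  psum c k = 0%R -> (k %| psum j k)%Z ->
  forall_lt k (fun b => forall_lt b (fun a =>
    [/\ `|(psum c b - psum c a)%R| < 2 * M,
        psum c b = psum c a -> ~~ (k %| (psum j b - psum j a)%R)%Z,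
        psum c b = (psum c a + M%:Z)%R -> ~~ (k %| (psum j b - psum j a + 1)%R)%Z
      & psum c b = (psum c a - M%:Z)%R -> ~~ (k %| (psum j b - psum j a - 1)%R)%Z])) ->
  closed_simple (k * M) k (fun t => (c t + j t * M%:Z)%R).
Proof.
move=> c0 j0 /forall_ltP sep; split.
  by rewrite psum_layers c0 add0r PoszM dvdz_mul.
move=> a b ab /sep/forall_ltP/(_ a ab)[lt S0 S1 SN]; apply/negP => D.
have [|s E [Ds s1]] := @dvdz_layer k M _ (psum j b - psum j a)%R lt.
  by apply: dvdz_eq D _; rewrite !psum_layers; ring.
have Eb : psum c b = (psum c a + s * M%:Z)%R by rewrite -E; ring.
have [s0|[s0|s0]] : (s = 0 \/ s = 1 \/ s = -1)%R by clear -s1; lia.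
- by rewrite s0 mul0r addr0 in Eb; have /negP[] := S0 Eb; rewrite s0 addr0 in Ds.
- by rewrite s0 mul1r in Eb; have /negP[] := S1 Eb; rewrite s0 in Ds.
- by rewrite s0 mulN1r in Eb; have /negP[] := SN Eb; rewrite s0 in Ds.
Qed.

(** Cells equal up to sign have classes of equal absolute value, so two cells with classes from [x]
    share their index modulo n and only signed layers remain to be compared. The main diagonal, at
    layer 0, is told apart from the others by the layer alone. *)
Lemma table_array n k (main : (nat -> int) -> nat -> int) (x : nat -> int)
    (shape : nat -> option (bool * nat)) (d : nat -> nat) (K : nat)
    (j : nat -> nat -> int) :
  spread n x -> spread n (main x) ->
  (forall t, t < k -> d t <= K /\ d t < n) ->
  (forall t u, t < k -> u < k -> d t = d u -> t = u) ->
  (forall i t, t < k -> shape t = None -> j i t = 0%R) ->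
  (forall i i' t u, t < k -> u < k ->
    (if shape t is Some (_, s) then
       if shape u is Some (_, s') then i + s = i' + s' %[mod n] else True else True) ->
    (k %| (signed_layer (shape t) (j i t) - signed_layer (shape u) (j i' u))%R)%Z ->
    t = u) ->
  (forall i, closed_simple (k * (2 * n + 1)) k
    (fun t => (cell_class main x (shape t) i + j i t * (2 * n + 1)%N%:Z)%R)) ->
  (forall i, closed_simple (k * (2 * n + 1)) k
    (fun t => (cell_class main x (shape t) (i + (K - d t))
               + j (i + (K - d t))%N t * (2 * n + 1)%N%:Z)%R)) ->
  layered_array n k d K (fun i t => cell_class main x (shape t) i) j.
Proof.
move=> [P R I] [Pm Rm Im] dK dI j0 inj row col; split=> //.
- by move=> t /dK[].
- by move=> t u ltt ltu; rewrite !modn_small; [apply: dI | case: (dK u ltu) | case: (dK t ltt)].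
- move=> i i' t ltt E; rewrite /cell_class; case: (shape t) => [[neg s]|]; last exact: Pm.
  by rewrite (P (i + s) (i' + s)) // -modnDml E modnDml.
- move=> i t ltt; rewrite /cell_class; case: (shape t) => [[[] s]|].
  + by rewrite abszN.
  + exact: R.
  + exact: Rm.
move=> i i' t u ltt ltu H.
have H1 : `|cell_class main x (shape t) i| = `|cell_class main x (shape u) i'|.
  by case: H => [] [->]; rewrite ?abszN.
have tu : t = u.
  have := inj i i' t u ltt ltu; move: H H1; have := j0 i t ltt; have := j0 i' u ltu.
  rewrite /cell_class /signed_layer.
  case: (shape t) => [[neg s]|]; case: (shape u) => [[neg' s']|].
  - move=> _ _ H H1; have E : i + s = i' + s' %[mod n].
      by apply: I; move: H1; case: neg {H}; case: neg'; rewrite ?abszN.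
    move=> /(_ E); apply; move: H; rewrite (P _ _ E); have := R (i' + s').
    by case: neg {H1}; case: neg' => ? [] [? D]; (try by exfalso; lia);
      (apply: dvdz_eqN D _ + apply: dvdz_eq D _); ring.
  - move=> /(_ erefl)-> _ H _ /(_ Logic.I); apply; rewrite subr0.
    by case: neg H => -[] [_]; rewrite ?rpredN ?subr0 ?addr0.
  - move=> _ /(_ erefl)-> H _ /(_ Logic.I); apply; rewrite sub0r rpredN.
    by case: neg' H => -[] [_]; rewrite ?sub0r ?add0r ?rpredN.
  by move=> _ _ _ _ /(_ Logic.I); apply; rewrite subrr dvdz0.
split=> //; move: H1; rewrite -tu /cell_class; case: (shape t) => [[neg s]|]; last exact: Im.
have E a : `|(if neg then - x a else x a)%R| = `|x a| by case: neg; rewrite ?abszN.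
by rewrite !E => /I/eqP; rewrite eqn_modDr => /eqP.
Qed.

(* One line per cell of a row, in the order in which the cycle runs through
   them: offset of the diagonal, shape of the class, layer. *)
Definition table := seq (nat * option (bool * nat) * int).

Section Tables.

Variable tab : table.

Definition offset t : nat := (nth (0, None, 0%R) tab t).1.1.
Definition shape t : option (bool * nat) := (nth (0, None, 0%R) tab t).1.2.
Definition layer t : int := (nth (0, None, 0%R) tab t).2.

Definition table_ok : bool :=
  let k := size tab in
  [&& all (fun t => offset t < k) (iota 0 k), uniq (map offset (iota 0 k)),
      all (fun t => (shape t == None) ==> (layer t == 0%R)) (iota 0 k)
    & uniq [seq (signed_layer (shape t) (layer t) %% k)%Z | t <- iota 0 k]].

Definition bounded_nonzero (n : nat) (z : int) : Prop :=
  [/\ (- n%:Z <= z)%R, (z <= n%:Z)%R & z <> 0%R].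

(** The properties of a spread sequence on windows of length n, without absolute values or residues,
    as linear arithmetic can use them. *)
Definition separated (n : nat) (f : nat -> int) : Prop :=
  (forall a, bounded_nonzero n (f a)) /\
  (forall a b, a < b -> b - a < n -> f a <> f b /\ (f a + f b)%R <> 0%R).

Definition table_sums (n : nat) (main : (nat -> int) -> nat -> int) : Prop :=
  forall f : nat -> int, separated n f -> (forall a, bounded_nonzero n (main f a)) ->
  let k := size tab in
  closed_simple (k * (2 * n + 1)) k
    (fun t => (cell_class main f (shape t) 0 + layer t * (2 * n + 1)%N%:Z)%R) /\
  closed_simple (k * (2 * n + 1)) k
    (fun t => (cell_class main f (shape t) (k.-1 - offset t)
               + layer t * (2 * n + 1)%N%:Z)%R).

Lemma spread_separated n x i : spread n x -> separated n (fun s => x (i + s)).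
Proof.
case=> [_ R I]; split=> [a|a b ab lt]; first by have := R (i + a); split; lia.
suff: `|x (i + a)| <> `|x (i + b)| by lia.
move/I/eqP; rewrite eqn_modDl eq_sym => /eqP/eqP; rewrite eqn_mod_dvd; last exact: ltnW.
by move=> /dvdn_leq; lia.
Qed.

Lemma all_iota (P : pred nat) k t : all P (iota 0 k) -> t < k -> P t.
Proof. by move=> /allP A ltt; apply: A; rewrite mem_iota. Qed.

Lemma uniq_map_iota (T : eqType) (g : nat -> T) k : uniq (map g (iota 0 k)) ->
  forall t u, t < k -> u < k -> g t = g u -> t = u.
Proof.
move=> U t u ltt ltu E; apply/eqP.
have := U => /(nth_uniq (g 0)) => /(_ t u); rewrite !size_map size_iota ltt ltu.
by rewrite !(nth_map 0) ?size_iota // !nth_iota // E eqxx => /(_ isT isT) <-.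
Qed.

Lemma closed_simple_ext v k e e' : e =1 e' -> closed_simple v k e -> closed_simple v k e'.
Proof.
move=> E; have Ep t : psum e t = psum e' t by elim: t => //= t ->; rewrite E.
by case=> D S; split=> [|a b]; rewrite -!Ep //; apply: S.
Qed.

(** The layers do not depend on the row and [main] commutes with shifts, so that replacing [x] by
    its shift by [i] reduces every row and column to those in [table_sums]. *)
Lemma constant_table_array n (main : (nat -> int) -> nat -> int) (x : nat -> int) :
  size tab <= n -> table_ok ->
  (forall i a, main (fun s => x (i + s)) a = main x (i + a)) ->
  spread n x -> spread n (main x) -> table_sums n main ->
  layered_array n (size tab) offset (size tab).-1
    (fun i t => cell_class main x (shape t) i) (fun _ => layer).
Proof.
set k := size tab => kn /and4P[lt uo none ul] shift X B sums.
have cl i : forall c a, cell_class main (fun s => x (i + s)) c a = cell_class main x c (i + a).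
  by case=> [[neg s]|] a; rewrite /cell_class ?addnA.
have S i := sums _ (spread_separated i X).
have Bi i a : bounded_nonzero n (main (fun s => x (i + s)) a).
  by rewrite shift; case: B => _ /(_ (i + a)) ? _; split; lia.
apply: table_array => //.
- by move=> t /(all_iota lt) /= ?; lia.
- exact: uniq_map_iota.
- by move=> _ t /(all_iota none)/implyP N E; apply/eqP/N/eqP.
- move=> i i' t u ltt ltu _ D; apply: (uniq_map_iota ul) => //.
  by apply/eqP; rewrite eqz_mod_dvd.
- move=> i; have [+ _] := S i (Bi i).
  by apply: closed_simple_ext => t /=; rewrite cl addn0.
move=> i; have [_ +] := S i (Bi i).
by apply: closed_simple_ext => t /=; rewrite cl.
Qed.

End Tables.

(** * The tables for k other than 6 and their partial sums *)

Definition table3 : table :=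
  [:: (0, Some (false, 0), (-1)%R); (1, None, 0%R); (2, Some (false, 1), 1%R)].

(** With it [table3] has the row x_0, -(x_0+x_1), x_1 and the column x_2, -(x_1+x_2), x_1, both of
    sum zero. *)
Definition neg_sum (f : nat -> int) (a : nat) : int := (- (f a + f a.+1))%R.

(** With it [table5] has the row -x_0, x_0, x_2-x_1, x_1, -x_2 and the column -x_4, x_3, x_4-x_3,
    x_2, -x_2. *)
Definition next_difference (f : nat -> int) (a : nat) : int := (f a.+2 - f a.+1)%R.
(* A placeholder for tables in which no shape is [None]. *)
Definition no_main (f : nat -> int) (a : nat) : int := f a.

(* The four lines (x_i, l), (-x_i, -(l+1)), (-x_{i+2}, -(l+2)), (x_{i+2}, l+3) on
   consecutive diagonals cancel in rows and columns for every sequence x; table8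
   consists of two such blocks, and table7 and table9 add one block to table3 and
   table5. *)
Definition table4 : table :=
  [:: (0, Some (false, 0), 0%R); (1, Some (true, 0), (-1)%R);
      (2, Some (true, 2), (-2)%R); (3, Some (false, 2), 3%R)].

Definition table5 : table :=
  [:: (0, Some (true, 0), (-2)%R); (1, Some (false, 0), (-1)%R); (2, None, 0%R);
      (3, Some (false, 1), 1%R); (4, Some (true, 2), 2%R)].

(** From here on the lines leave the order of the diagonals: the order changes neither entries nor
    totals, only the partial sums, which must be distinct in rows and columns. *)
Definition table7 : table :=
  [:: (0, Some (false, 0), (-1)%R); (1, None, 0%R); (3, Some (false, 0), 2%R);
      (2, Some (false, 1), 1%R); (5, Some (true, 2), (-4)%R); (6, Some (false, 2), 5%R);
      (4, Some (true, 0), (-3)%R)].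

Definition table8 : table :=
  [:: (0, Some (false, 0), 0%R); (1, Some (true, 0), (-1)%R); (3, Some (false, 2), 3%R);
      (4, Some (false, 0), 4%R); (2, Some (true, 2), (-2)%R); (6, Some (true, 2), (-6)%R);
      (5, Some (true, 0), (-5)%R); (7, Some (false, 2), 7%R)].

Definition table9 : table :=
  [:: (0, Some (true, 0), (-2)%R); (1, Some (false, 0), (-1)%R); (2, None, 0%R);
      (3, Some (false, 1), 1%R); (5, Some (false, 0), 3%R); (4, Some (true, 2), 2%R);
      (6, Some (true, 0), (-4)%R); (7, Some (true, 2), (-5)%R); (8, Some (false, 2), 6%R)].

Ltac normalize_terms :=
  cbv [table3 table4 table5 table7 table8 table9 psum cell_class shape offset layer nth fst snd size
    neg_sum next_difference no_main
    neg_sum addn subn predn Nat.add Nat.sub Nat.pred forall_lt].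

Ltac bound_terms R f :=
  repeat match goal with |- context [f ?a] =>
    match goal with H : is_true (f a <= _)%R |- _ => fail 1 | _ => have [? ? _] := R a end end.

(** An unwanted equation between classes is refuted by the bounds, by one term being nonzero, or by
    two terms being neither equal nor opposite. *)
Ltac nonzero_term R N f :=
  solve [ clear R N; lia
        | match goal with |- context [f ?a] => have [_ _ ?] := R a; clear R N; lia end
        | match goal with |- context [f ?a] => match goal with |- context [f ?b] =>
            let lt := eval vm_compute in (a < b) in
            match lt with true => idtac end;
            have [? ?] := N a b isT ltac:(lia); clear R N; lia end end ].

(** For each pair of partial sums, a possible carry is excluded either by computing with the layers
    or by refuting the equation between classes. *)
Ltac check_block f R N :=
  apply: closed_simple_layers; [by normalize_terms; ring | by vm_compute |];
  normalize_terms;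
  repeat match goal with |- _ /\ _ => split | |- True => exact Logic.I end;
  (split;
  [ bound_terms R f; clear R N; lia
  | first [ by move=> _; vm_compute
          | match goal with |- ?E -> _ => suff: ~ E by [] end;
            bound_terms R f; nonzero_term R N f ] ..]).

Lemma table3_sums n : 3 <= n -> table_sums table3 n neg_sum.
Proof.
(* Naming [M] shields [2 * n + 1] from [normalize_terms], which unfolds additions. *)
move=> kn f [R N] B; have [M EM] : exists M, M = 2 * n + 1 by exists (2 * n + 1).
rewrite [size _]/= -EM; split.
  by move: (B 0); rewrite /neg_sum => -[? ? ?]; clear B; check_block f R N.
(* The main cell of the column lies in row 2 - 1 = 1, by its offset 1. *)
by move: (B 1); rewrite /neg_sum => -[? ? ?]; clear B; check_block f R N.
Qed.

Lemma table4_sums n main : 4 <= n -> table_sums table4 n main.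
Proof.
move=> kn f [R N] B; clear B; have [M EM] : exists M, M = 2 * n + 1 by exists (2 * n + 1).
rewrite [size _]/= -EM; split; check_block f R N.
Qed.

Lemma table5_sums n : 5 <= n -> table_sums table5 n next_difference.
Proof.
move=> kn f [R N] B; have [M EM] : exists M, M = 2 * n + 1 by exists (2 * n + 1).
rewrite [size _]/= -EM; split.
  by move: (B 0); rewrite /next_difference => -[? ? ?]; clear B; check_block f R N.
by move: (B 2); rewrite /next_difference => -[? ? ?]; clear B; check_block f R N.
Qed.

Lemma table7_sums n : 7 <= n -> table_sums table7 n neg_sum.
Proof.
move=> kn f [R N] B; have [M EM] : exists M, M = 2 * n + 1 by exists (2 * n + 1).
rewrite [size _]/= -EM; split.
  by move: (B 0); rewrite /neg_sum => -[? ? ?]; clear B; check_block f R N.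
by move: (B 5); rewrite /neg_sum => -[? ? ?]; clear B; check_block f R N.
Qed.

Lemma table8_sums n main : 8 <= n -> table_sums table8 n main.
Proof.
move=> kn f [R N] B; clear B; have [M EM] : exists M, M = 2 * n + 1 by exists (2 * n + 1).
rewrite [size _]/= -EM; split; check_block f R N.
Qed.

Lemma table9_sums n : 9 <= n -> table_sums table9 n next_difference.
Proof.
move=> kn f [R N] B; have [M EM] : exists M, M = 2 * n + 1 by exists (2 * n + 1).
rewrite [size _]/= -EM; split.
  by move: (B 0); rewrite /next_difference => -[? ? ?]; clear B; check_block f R N.
(* [B 6] concerns the main cell; [B 1] bounds [f 3 - f 2], which occurs as a partial sum of the
   column. *)
by move: (B 1) (B 6); rewrite /next_difference => -[? ? _] [? ? ?]; clear B; check_block f R N.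
Qed.

Definition successors (n i : nat) : int := (i %% n).+1%:Z%R.

Lemma successors_spread n : 0 < n -> spread n (successors n).
Proof.
move=> n0; apply: (spread_cyclic (y := fun i => i.+1%:Z%R)) => // i i' _ _; lia.
Qed.

(** * The case k = 6 *)

(* The layers of this table are those of the even rows. *)
Definition table6 : table :=
  [:: (0, Some (false, 0), 0%R); (1, Some (true, 0), (-1)%R); (2, Some (false, 1), 0%R);
      (3, Some (true, 1), (-1)%R); (6, Some (false, 4), 4%R); (4, Some (true, 4), (-2)%R)].

(** If layers were constant on diagonals, a row total would have the parity of 0+1+...+5 = 15 and
    could not vanish modulo 6. Hence a second set for odd rows; row parity is well defined modulo
    the even n. *)
Definition odd_layers6 : seq int := [:: 2; -5; 5; -3; 4; -3]%R.

Definition layer6 (o : bool) (t : nat) : int :=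
  if o then nth 0%R odd_layers6 t else layer table6 t.

Lemma table6_sums n f (o : bool) : 8 <= n -> separated n f ->
  closed_simple (6 * (2 * n + 1)) 6
    (fun t => (cell_class no_main f (shape table6 t) 0 + layer6 o t * (2 * n + 1)%N%:Z)%R) /\
  closed_simple (6 * (2 * n + 1)) 6
    (fun t => (cell_class no_main f (shape table6 t) (6 - offset table6 t)
       + layer6 (o (+) odd (6 - offset table6 t)) t * (2 * n + 1)%N%:Z)%R).
Proof.
move=> kn [R N]; have [M EM] : exists M, M = 2 * n + 1 by exists (2 * n + 1).
rewrite -EM; split; case: o; rewrite /table6; check_block f R N.
Qed.

Lemma table6_array n : 8 <= n -> ~~ odd n ->
  layered_array n 6 (offset table6) 6
    (fun i t => cell_class no_main (successors n) (shape table6 t) i)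
    (fun i t => layer6 (odd i) t).
Proof.
move=> kn en; have X : spread n (successors n) by apply: successors_spread; lia.
have cl i : forall c a, cell_class no_main (fun s => successors n (i + s)) c a
    = cell_class no_main (successors n) c (i + a).
  by case=> [[neg s]|] a; rewrite /cell_class ?addnA.
apply: table_array => //.
- have chk : all (fun t => offset table6 t <= 6) (iota 0 6) by vm_compute.
  by move=> t /(all_iota chk) /= ?; lia.
- exact: uniq_map_iota.
- have chk : all (fun t => shape table6 t != None) (iota 0 6) by vm_compute.
  by move=> i t /(all_iota chk) /eqP.
- move=> i i' t u ltt ltu E D.
  (* Only the parity of the class index is kept; since n is even, [E] preserves it, and four pairs
     of row parities remain to be computed. *)
  pose par (o : bool) t := if shape table6 t is Some (_, s) then o (+) odd s else o.
  pose clash o o' t u := (par o t == par o' u) &&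
    (6 %| (signed_layer (shape table6 t) (layer6 o t)
           - signed_layer (shape table6 u) (layer6 o' u))%R)%Z.
  have chk : all (fun t => all (fun u => [&& clash true true t u ==> (t == u),
      clash true false t u ==> (t == u), clash false true t u ==> (t == u)
      & clash false false t u ==> (t == u)]) (iota 0 6)) (iota 0 6) by vm_compute.
  have some : all (fun t => shape table6 t != None) (iota 0 6) by vm_compute.
  have : clash (odd i) (odd i') t u.
    rewrite /clash D andbT /par; move: (all_iota some ltt) (all_iota some ltu) E.
    case: (shape table6 t) => [[? s]|] //; case: (shape table6 u) => [[? s']|] // _ _ E.
    rewrite -!oddD (divn_eq (i + s) n) (divn_eq (i' + s') n) E !oddD !oddM.
    by rewrite (negPf en) !andbF.
  have /and4P := all_iota (all_iota chk ltt) ltu.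
  by case: (odd i); case: (odd i') => -[/implyP A /implyP B /implyP C /implyP G] H;
    apply/eqP; auto.
- move=> i; have [+ _] := table6_sums (odd i) kn (spread_separated i X).
  by apply: closed_simple_ext => t /=; rewrite cl addn0.
move=> i; have [_ +] := table6_sums (odd i) kn (spread_separated i X).
by apply: closed_simple_ext => t /=; rewrite cl oddD.
Qed.

(* The offsets 0 and 6 of table6 coincide modulo n = 6, whence an ad hoc array. *)
Definition small_class6 (r t : nat) : int :=
  let eps := if odd r then [:: -1; 1; 1; -1; 1; -1]%R else [:: 1; -1; 1; 1; -1; -1]%R in
  let s := if odd r then [:: 4; 4; 5; 2; 2; 5] else [:: 0; 0; 1; 2; 1; 2] in
  (nth 0 eps t * ((r + nth 0%N s t) %% 6).+1%:Z)%R.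

Definition small_layer6 (r t : nat) : int :=
  nth 0%R (if odd r then [:: -2; 3; 5; -1; 5; -4]%R else [:: 0; -1; 0; 2; -4; -3]%R) t.

Definition closed_simpleb (v k : nat) (e : nat -> int) : bool :=
  (v %| psum e k)%Z &&
  all (fun b => all (fun a => ~~ (v %| (psum e b - psum e a)%R)%Z) (iota 0 b)) (iota 0 k).

Lemma closed_simpleP v k e : closed_simpleb v k e -> closed_simple v k e.
Proof.
case/andP=> D A; split=> // a b ab bk.
exact: (all_iota (all_iota A bk) ab).
Qed.

(** Everything depends on the row modulo 6, so each field is a finite computation. *)
Lemma small_array6 : layered_array 6 6 id 5
  (fun i t => small_class6 (i %% 6) t) (fun i t => small_layer6 (i %% 6) t).
Proof.
have lt6 i : i %% 6 < 6 by rewrite ltn_pmod.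
split=> //.
- by move=> t u ltt ltu; rewrite !modn_small.
- by move=> i i' t _ ->.
- move=> i t; move: (i %% 6) (lt6 i) => r.
  have chk : all (fun r => all (fun t => 0 < `|small_class6 r t| <= 6) (iota 0 6)) (iota 0 6).
    by vm_compute.
  by move=> ltr ltt; apply: (all_iota (all_iota chk ltr) ltt).
- move=> i i' t u; move: (i %% 6) (lt6 i) (i' %% 6) (lt6 i') => r ltr r' ltr' ltt ltu H.
  pose same a b c d :=
    (small_class6 a b == small_class6 c d)
      && (6 %| (small_layer6 a b - small_layer6 c d)%R)%Z
    || (small_class6 a b == - small_class6 c d)%R
      && (6 %| (small_layer6 a b + small_layer6 c d)%R)%Z.
  have chk : all (fun a => all (fun b => all (fun c => all (fun d =>
      same a b c d ==> (b == d) && (a == c)) (iota 0 6)) (iota 0 6)) (iota 0 6)) (iota 0 6).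
    by vm_compute.
  have /implyP imp := all_iota (all_iota (all_iota (all_iota chk ltr) ltt) ltr') ltu.
  have /imp/andP[/eqP-> /eqP->] // : same r t r' u.
  by rewrite /same; case: H => -[-> ->]; rewrite eqxx ?orbT.
- move=> i; apply: closed_simpleP; move: (i %% 6) (lt6 i) => r.
  by case: r => [|[|[|[|[|[|r]]]]]] // _; vm_compute.
move=> i; apply: (@closed_simple_ext _ _ (fun t => small_class6 ((i %% 6 + (5 - t)) %% 6) t
    + small_layer6 ((i %% 6 + (5 - t)) %% 6) t * (2 * 6 + 1)%N%:Z)%R).
  by move=> t; rewrite modnDml.
apply: closed_simpleP; move: (i %% 6) (lt6 i) => r.
by case: r => [|[|[|[|[|[|r]]]]]] // _; vm_compute.
Qed.

Theorem proposition6p2 (n k : nat) (hk : 0 < k) (hnk : k <= n)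
  (hcases :
     [\/ k \in [:: 3; 7; 9] /\ (n = 0 %[mod 4] \/ n = 3 %[mod 4]),
         k = 5 /\ n = 3 %[mod 4],
         k \in [:: 4; 8]
       | k = 6 /\ ~~ odd n]) :
  exists D D' : {set subgraph ('I_(2 * n + 1) * 'I_k)%type},
    [/\ cycle_decomposition (@complete_multipartite (2 * n + 1) k) k D,
        cycle_decomposition (@complete_multipartite (2 * n + 1) k) k D',
        cyclic_decomposition D,
        cyclic_decomposition D'
      & orthogonal_decompositions D D'].
Proof.
have sum_case tab : size tab <= n -> table_ok tab -> table_sums tab n neg_sum ->
    n = 0 %[mod 4] \/ n = 3 %[mod 4] ->
    exists c, layered_array n (size tab) (offset tab) (size tab).-1 c (fun _ => layer tab).
  move=> kn ok sums /sum_sequence[|x [X [P R I]]]; first by lia.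
  eexists; apply: (constant_table_array kn ok _ X _ sums) => [i a|].
    by rewrite /neg_sum addnS.
  by split=> [i i' E|i|i i']; rewrite /neg_sum ?abszN; [rewrite (P _ _ E)|apply: R|apply: I].
have diff_case tab : 4 <= n -> size tab <= n -> table_ok tab ->
    table_sums tab n next_difference -> n = 0 %[mod 4] \/ n = 3 %[mod 4] ->
    exists c, layered_array n (size tab) (offset tab) (size tab).-1 c (fun _ => layer tab).
  move=> n4 kn ok sums /(difference_sequence n4)[x [X [P R I]]].
  eexists; apply: (constant_table_array kn ok _ X _ sums) => [i a|].
    by rewrite /next_difference !addnS.
  rewrite /next_difference; split=> [i i' E|i|i i' /I/eqP].
  - by apply: P; apply/eqP; rewrite -(addn1 i) -(addn1 i') eqn_modDr; apply/eqP.
  - exact: R.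
  - by rewrite -(addn1 i) -(addn1 i') eqn_modDr => /eqP.
(* Any spread sequence serves here, and [no_main] returns it unchanged, so one fact gives both
   spread conditions. *)
have plain_case tab : 0 < n -> size tab <= n -> table_ok tab -> table_sums tab n no_main ->
    exists c, layered_array n (size tab) (offset tab) (size tab).-1 c (fun _ => layer tab).
  move=> n0 kn ok sums; eexists.
  exact: (constant_table_array kn ok _ (successors_spread n0) (successors_spread n0) sums).
suff [k_gt2 [d [K [c [j A]]]]] : 2 < k /\ exists d K c j, layered_array n k d K c j.
  exact: layered_array_decompositions A k_gt2.
case: hcases => [[k379 n4]|[k5 n4]|k48|[k6 en]].
- move: k379; rewrite !inE => /or3P[] /eqP ek; move: hnk; rewrite ek => hnk; split=> //.
  + by have [c A] := sum_case table3 hnk isT (table3_sums hnk) n4; do 4!eexists; apply: A.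
  + by have [c A] := sum_case table7 hnk isT (table7_sums hnk) n4; do 4!eexists; apply: A.
  have n4' : 4 <= n by lia.
  by have [c A] := diff_case table9 n4' hnk isT (table9_sums hnk) n4; do 4!eexists; apply: A.
- move: hnk; rewrite k5 => hnk; split=> //; have n4' : 4 <= n by lia.
  have [c A] := diff_case table5 n4' hnk isT (table5_sums hnk) (or_intror n4).
  by do 4!eexists; apply: A.
- have n0 : 0 < n by lia.
  move: k48 hnk; rewrite !inE => /orP[] /eqP-> hnk; split=> //.
    by have [c A] := plain_case table4 n0 hnk isT (table4_sums hnk); do 4!eexists; apply: A.
  by have [c A] := plain_case table8 n0 hnk isT (table8_sums hnk); do 4!eexists; apply: A.
move: hnk; rewrite k6 => hnk; split=> //.
have [n8|] := leqP 8 n.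
  by do 4!eexists; apply: table6_array.
move=> lt8; have n6 : n = 6 by lia.
by rewrite n6; do 4!eexists; apply: small_array6.
Qed.
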